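(* There is an absolute constant $c>0$ such that for every $K\ge 1$ there is a constant $C=C(K)>0$ with the following property. Let $A\subset\mathbb{R}$ be a finite set with $|A|\ge 2$ and $|AA|\le K|A|$. Then $$\mathsf{E}^{+}(A)\le C\,|A|^{22/9}\,(\log|A|)^{c}.$$
   Context: For a finite set $A\subset\mathbb{R}$, $AA=\{ab : a,b\in A\}$ is the product set and $\mathsf{E}^{+}(A)=|\{(a,b,c,d)\in A^4 : a+b=c+d\}|$ is the additive energy. Logarithms are to base $2$. *)

(* Defs.v *)
From mathcomp Require Export all_boot all_order all_algebra.
From mathcomp Require Export finmap.
From mathcomp Require Export reals exp.

Set Implicit Arguments.
Unset Strict Implicit.
Unset Printing Implicit Defensive.

Import Order.TTheory GRing.Theory Num.Theory.

Local Open Scope ring_scope.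
Local Open Scope fset_scope.

Definition prodset (R : realType) (A : {fset R}) : {fset R} :=
  [fset (a * b)%R | a in A, b in A].

(* A quadruple (a, b, c, d) is encoded as ((a, b), (c, d)). *)
Definition add_energy (R : realType) (A : {fset R}) : nat :=
  #|` [fset q in (A `*` A) `*` (A `*` A) | (q.1.1 + q.1.2 == q.2.1 + q.2.2)%R]|.

Definition log2 (R : realType) (x : R) : R := (ln x / ln 2)%R.

(* Main.v *)
Require Import Defs.
From mathcomp Require Import zify ring lra.

Set Implicit Arguments.
Unset Strict Implicit.
Unset Printing Implicit Defensive.

Import Order.TTheory GRing.Theory Num.Theory.

(** Write [n] for the size of [A], [r x] for the number of pairs [(u, v)] in
[A x A] with [u - v = x], and [E] for the additive energy.  The bound comes
from playing a spectral lower bound against incidence geometry.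

Spectral side ([energy_cube], [offdiag_sqr]).  The matrix [r (x - y)] indexed
by [A] is a Gram matrix and its entries sum to [E], so its largest eigenvalue is
at least [E / n] and the trace of its cube is at least [(E / n) ^ 3].  That trace
is the sum of [r (x - y) * r (y - z) * r (z - x)] over triples of [A].  Grouping
the triples by the two differences [a = x - y] and [c = z - y] and applying
Cauchy-Schwarz gives, up to diagonal terms, [(E / n) ^ 6 <= G * F], where [F] is
the sum of [r a ^ 3] over all [a] and [G] is the sum of
[(r a * r c * r (a - c)) ^ 2] over all [a] and [c].

Incidence side ([grid_szemeredi_trotter]).  For finite [T], [X], [S], [B] with
[0] in neither [T] nor [S], the equation [x = s * t - b] has
[O((|T| |X| |S| |B|) ^ (2/3))] solutions.  This is the Szemeredi-Trotter theorem
for a grid of points; on a grid the cell decomposition is elementary, because a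
line meets few of the rectangles into which the grid is cut.

Multiplicative structure makes that bound efficient, in two ways.  Let
[P i] be the set of nonzero [x] with [2 ^ i <= r x].
- If [x = u - v] and [a], [c] are in [A] then [a * x = (u / c) * (a * c) - a * v],
  where [u / c] is in [A / A] and [a * c], [a * v] are in [A A].  Both sets have
  size [O(n)], so each element of [A (P i)] yields [n * 2 ^ i] incidences, and
  [|A (P i)| = O(n ^ 3 / 8 ^ i)] ([size_dilates_popular]).  In particular
  [F = O(n ^ 3 log n)].
- If [x - y = z] then [(a * x) * a^-1 - y = z] for all [n] choices of [a] in [A].
  This bounds the number of such triples in [P i], [P j], [P k] by
  [O(n ^ (17/3) / 4 ^ (i + j + k))] ([triples_bound], [level_triples]), exactly
  what the squares in [G] ask for: [G = O(n ^ (17/3) log ^ 3 n)].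

Hence [E ^ 6 = O(n ^ 6 * n ^ 3 * n ^ (17/3) log ^ 4 n)], that is
[E = O(n ^ (22/9) log n)] with room to spare in the logarithm.  The value [r 0 = n] would ruin the bound on [G], so
the diagonal triples are split off first; they contribute [n * F] to the trace,
which alone would give [E = O(n ^ (7/3) log n)].  Removing [0] from [A] changes
[E] by [O(n ^ 2)].  All inequalities up to [energy_bound] are between natural
numbers, with fractional exponents cleared by taking powers. *)

Local Open Scope nat_scope.

(** * Finite sums and Cauchy-Schwarz *)

Lemma sum_bool_size (I : Type) (s : seq I) (P : pred I) :
  \sum_(x <- s) (P x : nat) = size (filter P s).
Proof.
rewrite size_filter -sum1_count [RHS]big_mkcond /=.
by apply: eq_bigr => x _; case: (P x).
Qed.

Lemma sum_bool_mem (I : eqType) (s : seq I) (v : I) :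
  uniq s -> \sum_(x <- s) (x == v : nat) = (v \in s).
Proof. by move=> us; rewrite sum_bool_size size_filter count_uniq_mem. Qed.

Lemma leq_sum_inj (I J : eqType) (s : seq I) (t : seq J) (P : pred I)
    (Q : pred J) (f : I -> J) :
    uniq s -> {in [pred x | (x \in s) && P x] &, injective f} ->
    (forall x, x \in s -> P x -> (f x \in t) && Q (f x)) ->
  \sum_(x <- s) (P x : nat) <= \sum_(y <- t) (Q y : nat).
Proof.
move=> us injf sft; rewrite !sum_bool_size -(size_map f).
apply: uniq_leq_size.
  rewrite map_inj_in_uniq ?filter_uniq // => x y.
  rewrite !mem_filter => /andP[Px xs] /andP[Py ys]; apply: injf;
  by rewrite inE /= ?xs ?ys.
move=> _ /mapP[x + ->]; rewrite !mem_filter => /andP[Px xs].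
by rewrite andbC; apply: sft.
Qed.

Lemma mem_pairs (I J : eqType) (s : seq I) (t : seq J) (p : I * J) :
  (p \in [seq (x, y) | x <- s, y <- t]) = (p.1 \in s) && (p.2 \in t).
Proof.
apply/allpairsP/andP => [[[x y] /= [xs yt ->]] //|[xs yt]].
by exists p; split=> //; case: p {xs yt}.
Qed.

Lemma pairs_uniq (I J : eqType) (s : seq I) (t : seq J) :
  uniq s -> uniq t -> uniq [seq (x, y) | x <- s, y <- t].
Proof. by move=> us ut; apply: allpairs_uniq => // -[x y] [x' y'] _ _ []->->. Qed.

Lemma sum_cauchy_schwarz (I : Type) (s : seq I) (f g : I -> nat) :
  (\sum_(i <- s) f i * g i) ^ 2 <=
  (\sum_(i <- s) f i ^ 2) * (\sum_(i <- s) g i ^ 2).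
Proof.
rewrite -(@leq_pmul2l 2) // expnS expn1 !big_distrlr /=.
apply: (@leq_trans (\sum_(i <- s) \sum_(j <- s)
    (f i ^ 2 * g j ^ 2 + f j ^ 2 * g i ^ 2))).
  rewrite big_distrr; apply: leq_sum => i _ /=.
  rewrite big_distrr; apply: leq_sum => j _ /=.
  by have [+ _] := nat_Cauchy (f i * g j) (f j * g i); rewrite !expnMn; lia.
apply: eq_leq; under eq_bigr do rewrite big_split /=.
by rewrite big_split /= mul2n -addnn [X in _ + X]exchange_big.
Qed.

Lemma sum_cauchy_schwarz2 (I J : Type) (s : seq I) (t : seq J)
    (f g : I -> J -> nat) :
  (\sum_(i <- s) \sum_(j <- t) f i j * g i j) ^ 2 <=
  (\sum_(i <- s) \sum_(j <- t) f i j ^ 2) *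
  (\sum_(i <- s) \sum_(j <- t) g i j ^ 2).
Proof.
have := sum_cauchy_schwarz [seq (x, y) | x <- s, y <- t]
  (fun p => f p.1 p.2) (fun p => g p.1 p.2).
by rewrite !big_allpairs.
Qed.

Lemma sqr_sum_leq (I : Type) (s : seq I) (f : I -> nat) :
  (\sum_(i <- s) f i) ^ 2 <= size s * \sum_(i <- s) f i ^ 2.
Proof.
have := sum_cauchy_schwarz s (fun=> 1) f.
by rewrite big_const_seq count_predT iter_addn_0 mul1n; under eq_bigr do rewrite mul1n.
Qed.

Section Gram.
Variables (I J : Type) (s : seq I) (D : seq J) (B : I -> J -> nat).
Let G x y := \sum_(t <- D) B x t * B y t.

(** This is the inequality between the Rayleigh quotient of the all-ones vector
[1] and the trace of the cube, for [G = B B^T].  With [a_k = 1^T G^k 1], two uses of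
Cauchy-Schwarz give [a_1 ^ 2 <= a_0 a_2] and [a_2 ^ 2 <= a_1 a_3], hence
[a_1 ^ 3 <= a_0 ^ 2 a_3]; a third gives [a_3 <= a_0 tr (G ^ 3)], because [G ^ 3]
is the Gram matrix of the rows of [G B]. *)
Lemma gram_sum_cube :
  (\sum_(x <- s) \sum_(y <- s) G x y) ^ 3 <=
  size s ^ 3 * \sum_(x <- s) \sum_(y <- s) \sum_(z <- s) G x y * G y z * G z x.
Proof.
set a1 := (X in X ^ 3); set tr := (X in _ <= _ * X).
have GC x y : G x y = G y x by apply: eq_bigr => t _; rewrite mulnC.
(* [w], [p], [q] are the vectors [B^T 1], [G 1], [B^T G 1], and [C] is [G B]. *)
pose w t := \sum_(x <- s) B x t.
pose p x := \sum_(y <- s) G x y.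
pose q t := \sum_(x <- s) B x t * p x.
pose C y t := \sum_(x <- s) G y x * B x t.
have pE x : p x = \sum_(t <- D) B x t * w t.
  rewrite /p /G exchange_big; apply: eq_bigr => t _.
  by rewrite big_distrr.
have a1E : a1 = \sum_(t <- D) w t ^ 2.
  transitivity (\sum_(x <- s) p x) => //.
  under eq_bigr do rewrite pE.
  rewrite exchange_big; apply: eq_bigr => t _ /=.
  by rewrite -big_distrl.
pose a2 := \sum_(x <- s) p x ^ 2.
have a2E : a2 = \sum_(t <- D) w t * q t.
  transitivity (\sum_(x <- s) \sum_(t <- D) (B x t * p x) * w t).
    apply: eq_bigr => x _; rewrite expnS expn1 {2}pE big_distrr.
    by apply: eq_bigr => t _ /=; ring.
  rewrite exchange_big; apply: eq_bigr => t _ /=.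
  by rewrite -big_distrl mulnC.
pose a3 := \sum_(t <- D) q t ^ 2.
have a12 : a1 ^ 2 <= size s * a2 by apply: sqr_sum_leq.
have a23 : a2 ^ 2 <= a1 * a3 by rewrite a2E a1E; apply: sum_cauchy_schwarz.
have qE t : q t = \sum_(y <- s) C y t.
  rewrite /q /C exchange_big; apply: eq_bigr => x _ /=.
  rewrite /p big_distrr; apply: eq_bigr => y _ /=.
  by rewrite (GC x) mulnC.
have a3tr : a3 <= size s * tr.
  have -> : tr = \sum_(t <- D) \sum_(y <- s) C y t ^ 2.
    rewrite /tr exchange_big [RHS]exchange_big; apply: eq_bigr => y _ /=.
    transitivity (\sum_(t <- D) \sum_(x <- s) \sum_(z <- s)
        (G y x * B x t) * (G y z * B z t)).
      rewrite [RHS]exchange_big; apply: eq_bigr => x _ /=.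
      rewrite [RHS]exchange_big; apply: eq_bigr => z _ /=.
      rewrite (GC z x) (GC x y) {3}/G big_distrr /=.
      by apply: eq_bigr => t _ /=; ring.
    by apply: eq_bigr => t _; rewrite expnS expn1 big_distrlr.
  rewrite big_distrr /=; apply: leq_sum => t _.
  by rewrite qE; apply: sqr_sum_leq.
have [->|a1_gt0] := posnP a1; first by rewrite exp0n.
rewrite -(leq_pmul2l a1_gt0) -expnS.
have : (a1 ^ 2) ^ 2 <= (size s * a2) ^ 2 by rewrite leq_exp2r.
rewrite -expnM => /leq_trans; apply.
rewrite expnMn; apply: (leq_trans (leq_mul (leqnn _) a23)).
have : size s ^ 2 * a1 * a3 <= size s ^ 2 * a1 * (size s * tr).
  by rewrite leq_mul2l a3tr orbT.
move=> h; apply: (leq_trans (n := size s ^ 2 * a1 * a3)); first by rewrite mulnA.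
by apply: (leq_trans h); apply: eq_leq; ring.
Qed.
End Gram.

(** * The Szemeredi-Trotter bound on a grid *)

Lemma sum_nat_leq_const (I : eqType) (s : seq I) (f : I -> nat) c :
  (forall x, x \in s -> f x <= c) -> \sum_(x <- s) f x <= size s * c.
Proof.
move=> fc; rewrite -(count_predT s) -sum1_count big_distrl /= !big_seq.
by apply: leq_sum => x xs; rewrite mul1n fc.
Qed.

(** Elements whose value under [f] is attained at no later element of [H] number
at most [m]; every other element takes part in a collision. *)
Lemma size_leq_collisions (I : eqType) (H : seq I) (f : I -> nat) m :
    uniq H -> {in H, forall x, f x < m} ->
  size H <= m + \sum_(x <- H) \sum_(y <- H) ((x != y) && (f x == f y) : nat).
Proof.
move=> uH fm; apply: (@leq_trans (size (undup (map f H)) +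
    \sum_(x <- H) \sum_(y <- H) ((x != y) && (f x == f y) : nat))); last first.
  rewrite leq_add2r -(size_iota 0 m); apply: uniq_leq_size (undup_uniq _) _.
  by move=> y; rewrite mem_undup mem_iota => /mapP[x xH ->]; apply: fm.
clear fm; elim: H uH => [|x H IH] //= /andP[xH /IH {}IH].
rewrite big_cons [X in _ <= _ + (X + _)]big_cons eqxx add0n /=.
set S1 := \sum_(y <- H) _; set S2 := \sum_(j <- H) _.
pose S0 := \sum_(y <- H) \sum_(z <- H) ((y != z) && (f y == f z) : nat).
have {}IH : size H <= size (undup (map f H)) + S0 by [].
have S02 : S0 <= S2 by apply: leq_sum => y _; rewrite big_cons leq_addl.
case: ifP => [/mapP[y yH fxy]|_] /=; last first.
  by rewrite addSn ltnS (leq_trans IH) // leq_add2l (leq_trans S02) // leq_addl.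
suff S1_gt0 : 0 < S1.
  by rewrite (leq_ltn_trans IH) // ltn_add2l (leq_ltn_trans S02) // -[X in X < _]add0n ltn_add2r.
rewrite /S1 (big_rem y) //= fxy eqxx andbT.
by case: eqVneq xH => // ->; rewrite yH.
Qed.

(** Cutting a set of reals into blocks of [q] consecutive elements: the block
of [t] is read off from the number of elements below [t], which makes blocks
monotone in [t] without sorting. *)
Section Rank.
Variables (R : realFieldType) (T : seq R).
Implicit Types t u : R.
Hypothesis uT : uniq T.

Definition rank t := count (fun u => (u < t)%R) T.

Lemma rank_le t u : (t <= u)%R -> rank t <= rank u.
Proof. by move=> tu; apply: sub_count => v /= vt; apply: lt_le_trans tu. Qed.

Lemma rank_lt t u : t \in T -> (t < u)%R -> rank t < rank u.
Proof.
move=> tT tu; rewrite /rank -!size_filter.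
apply: (@leq_trans (size (t :: [seq v <- T | (v < t)%R]))) => //.
apply: uniq_leq_size => [|v].
  by rewrite /= filter_uniq // mem_filter ltxx.
rewrite inE !mem_filter => /orP[/eqP->|/andP[vt ->]]; first by rewrite tu.
by rewrite (lt_trans vt tu).
Qed.

Lemma rank_inj : {in T &, injective rank}.
Proof.
move=> t u tT uT' e; case: (ltgtP t u) => // h.
- by have := rank_lt tT h; rewrite e ltnn.
- by have := rank_lt uT' h; rewrite e ltnn.
Qed.

Lemma rank_size t : rank t <= size T. Proof. exact: count_size. Qed.

Variable q : nat.
Definition block t := rank t %/ q.

Lemma block_le t u : (t <= u)%R -> block t <= block u.
Proof. by move=> /rank_le; apply: leq_div2r. Qed.

Lemma block_size t : block t <= size T %/ q.
Proof. exact: leq_div2r (rank_size t). Qed.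

Lemma size_block t : 0 < q -> \sum_(u <- T) (block t == block u : nat) <= q.
Proof.
move=> q0; have /leq_trans -> //: \sum_(u <- T) (block t == block u : nat) <=
    \sum_(m <- iota (block t * q) q) (predT m : nat).
  apply: (leq_sum_inj (f := rank)) => // [u v|u uT'].
    by rewrite !inE /= => /andP[? _] /andP[? _]; apply: rank_inj.
  rewrite andbT mem_iota => /eqP ->; rewrite /block leq_trunc_div /=.
  by rewrite addnC -mulSn -ltn_divLR.
by rewrite sum_bool_size filter_predT size_iota.
Qed.
End Rank.

Section Grid.
Variables (R : realFieldType) (T X : seq R).
Hypotheses (uT : uniq T) (uX : uniq X).
Implicit Types l : R * R.

Definition line l (t : R) : R := (l.1 * t - l.2)%R.

Definition incidences (L : seq (R * R)) :=
  \sum_(l <- L) \sum_(t <- T) (line l t \in X : nat).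

Lemma line_inj l : (l.1 != 0)%R -> injective (line l).
Proof. by move=> l0 t u /addIr /(mulfI l0). Qed.

Section Blocks.
Variables (qT qX : nat).
Let same_block (t u x y : R) :=
  (block T qT t == block T qT u) && (block X qX x == block X qX y).

(** Along a line both coordinates are monotone in [t], so the pair of blocks
(abscissa, ordinate) moves along a staircase and is determined by the sum [f] of
the two block numbers, the second one reversed if the slope is negative.  The
line therefore meets few cells, and its other incidences come in pairs within a
common cell. *)
Lemma line_richness l : (l.1 != 0)%R ->
  \sum_(t <- T) (line l t \in X : nat) <=
  (size T %/ qT + size X %/ qX).+1 +
  \sum_(t <- T) \sum_(u <- T) [&& t != u, line l t \in X, line l u \in X &
     same_block t u (line l t) (line l u)].
Proof.
move=> l0; rewrite sum_bool_size.
pose f t := if (0 < l.1)%R then block T qT t + block X qX (line l t)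
  else block T qT t + (size X %/ qX - block X qX (line l t)).
have fP t u : (t < u)%R -> f t = f u -> same_block t u (line l t) (line l u).
  move=> tu; rewrite /f /same_block.
  have := block_le T qT (ltW tu).
  have := block_size X qX (line l t); have := block_size X qX (line l u).
  case: (ltP 0 l.1)%R => [lp|lm].
    have : (line l t <= line l u)%R by rewrite lerD2r ler_pM2l // ltW.
    by move=> /(block_le X qX); lia.
  have : (line l u <= line l t)%R by rewrite lerD2r ler_wnM2l // ltW.
  by move=> /(block_le X qX); lia.
have fP' t u : t != u -> f t = f u -> same_block t u (line l t) (line l u).
  case: (ltgtP t u) => // [/fP//|ut _ /esym /(fP _ _ ut)].
  by rewrite /same_block ![block _ _ u == _]eq_sym ![block _ _ (line l u) == _]eq_sym.
apply: leq_trans (size_leq_collisions (f := f) (m := (size T %/ qT + size X %/ qX).+1) _ _) _.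
- exact: filter_uniq.
- move=> t _; rewrite /f ltnS.
  by case: ifP => _; apply: leq_add; rewrite ?block_size ?leq_subr.
rewrite leq_add2l big_filter big_mkcond; apply: leq_sum => t _.
case: ifP => tX //; rewrite big_filter big_mkcond; apply: leq_sum => u _.
case: ifP => // uX'; case: eqVneq => //= /fP' h.
by case: eqVneq => // /h ->.
Qed.

(** Two distinct points lie on at most one line, so the pairs of incidences in a
common cell inject into the pairs of points sharing a cell. *)
Lemma incidences_blocks (L : seq (R * R)) :
    uniq L -> {in L, forall l, l.1 != 0%R} -> 0 < qT -> 0 < qX ->
  incidences L <= size L * (size T %/ qT + size X %/ qX).+1 +
    (size T * qT) * (size X * qX).
Proof.
move=> uL L0 qT0 qX0.
pose m := (size T %/ qT + size X %/ qX).+1.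
apply: (@leq_trans (\sum_(l <- L) (m + \sum_(t <- T) \sum_(u <- T)
   [&& t != u, line l t \in X, line l u \in X &
     same_block t u (line l t) (line l u)]))).
  by rewrite /incidences !big_seq; apply: leq_sum => l /L0; apply: line_richness.
rewrite big_split /= leq_add //; first by apply: sum_nat_leq_const.
pose TT := [seq (t, u) | t <- T, u <- T]; pose XX := [seq (x, y) | x <- X, y <- X].
apply: (@leq_trans (\sum_(p <- [seq (a, b) | a <- TT, b <- XX])
    (same_block p.1.1 p.1.2 p.2.1 p.2.2 : nat))); last first.
  rewrite !big_allpairs /=.
  apply: (@leq_trans ((\sum_(t <- T) \sum_(u <- T) (block T qT t == block T qT u)) *
     \sum_(x <- X) \sum_(y <- X) (block X qX x == block X qX y))).
    rewrite big_distrl /=; apply: leq_sum => t _.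
    rewrite big_distrl /=; apply: leq_sum => u _.
    rewrite big_allpairs big_distrr /=; apply: leq_sum => x _.
    rewrite big_distrr /=; apply: leq_sum => y _.
    by rewrite /same_block mulnb.
  by apply: leq_mul; apply: sum_nat_leq_const => t _; apply: size_block.
have := @leq_sum_inj _ _ [seq (l, p) | l <- L, p <- TT]
  [seq (a, b) | a <- TT, b <- XX]
  (fun z => [&& z.2.1 != z.2.2, line z.1 z.2.1 \in X, line z.1 z.2.2 \in X &
     same_block z.2.1 z.2.2 (line z.1 z.2.1) (line z.1 z.2.2)])
  (fun p => same_block p.1.1 p.1.2 p.2.1 p.2.2)
  (fun z => (z.2, (line z.1 z.2.1, line z.1 z.2.2))).
rewrite big_allpairs; under eq_bigr do rewrite big_allpairs /=.
apply.
- by rewrite !pairs_uniq.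
- move=> [[s b] [t u]] [[s' b'] [t' u']]; rewrite !inE !mem_pairs /=.
  move=> /andP[_ /andP[tu _]] _ [<- <-]; rewrite /line /= => e1 e2.
  have ss' : s = s'.
    apply: (mulIf (x := (t - u)%R)); first by rewrite subr_eq0.
    by rewrite !mulrBr; move: e1 e2; lra.
  by move: e1; rewrite ss' => /addrI /oppr_inj ->.
- move=> [l [t u]]; rewrite !mem_pairs /= => /andP[_ /andP[-> ->]].
  by move=> /and4P[_ -> -> ->].
Qed.
End Blocks.
End Grid.

(** Optimisation of the block sizes in [incidences_blocks].  The best number [r]
of blocks per side satisfies [r ^ 3 L ~ (T X) ^ 2]; if this exceeds [T] or [X],
then [I <= T L] or [I <= X L] is already strong enough. *)
Lemma incidences_cube_leq (T X L : nat) (I : nat) :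
    0 < T -> 0 < X -> 0 < L ->
    I <= T * L -> I <= X * L -> L <= (T * X) ^ 2 ->
    (forall qT qX, 0 < qT -> 0 < qX ->
       I <= L * (T %/ qT + X %/ qX).+1 + (T * qT) * (X * qX)) ->
  I ^ 3 <= 13 ^ 3 * ((T * X * L) ^ 2).
Proof.
move=> T0 X0 L0 IT IX Lp Iq.
pose P r := r ^ 3 * L <= (T * X) ^ 2.
have exP : exists r, P r by exists 1; rewrite /P exp1n mul1n.
have ubP r : P r -> r <= (T * X) ^ 2.
  apply: leq_trans; apply: (@leq_trans (r ^ 3)); last exact: leq_pmulr.
  by case: r => // r; rewrite -[X in X <= _]expn1 leq_pexp2l.
case: (ex_maxnP exP ubP) => r Pr rmax.
have r0 : 0 < r by apply: rmax; rewrite /P exp1n mul1n.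
have Pr1 : (T * X) ^ 2 <= r.+1 ^ 3 * L.
  by rewrite leqNgt; apply/negP => /ltnW /rmax; rewrite ltnn.
have r8 : r.+1 ^ 3 <= 8 * r ^ 3.
  by rewrite -[8]/(2 ^ 3) -expnMn leq_exp2r // mul2n -addnn -addn1 leq_add2l.
(* [5 r L] for the cells met by the lines, [8 r L] for the pairs sharing a cell. *)
suff IrL : I <= 13 * r * L.
  apply: (@leq_trans ((13 * r * L) ^ 3)); first by rewrite leq_exp2r.
  have -> : (13 * r * L) ^ 3 = 13 ^ 3 * (r ^ 3 * L * L ^ 2) by rewrite !expnMn; ring.
  by rewrite [(_ * L) ^ 2]expnMn leq_mul2l leq_mul2r (Pr : _ <= _) orbT.
have [rT|Tr] := leqP r T; last first.
  by apply: (leq_trans IT); rewrite leq_mul2r; apply/orP; right; lia.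
have [rX|Xr] := leqP r X; last first.
  by apply: (leq_trans IX); rewrite leq_mul2r; apply/orP; right; lia.
have half m : 0 < m -> r <= m -> m %/ (m %/ r) <= 2 * r.
  move=> m0 rm; have q0 : 0 < m %/ r by rewrite divn_gt0.
  rewrite -ltnS ltn_divLR // mulSn -mulnA.
  have := ltn_ceil m r0; rewrite mulSn => h.
  have : r <= r * (m %/ r) by rewrite leq_pmulr.
  by move: h; rewrite [_ %/ _ * _]mulnC; lia.
have qT0 : 0 < T %/ r by rewrite divn_gt0.
have qX0 : 0 < X %/ r by rewrite divn_gt0.
apply: (leq_trans (Iq _ _ qT0 qX0)).
have h1 : L * (T %/ (T %/ r) + X %/ (X %/ r)).+1 <= L * (5 * r).
  rewrite leq_mul2l; apply/orP; right.
  by have := half T T0 rT; have := half X X0 rX; lia.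
have h2 : T * (T %/ r) * (X * (X %/ r)) <= 8 * r * L.
  rewrite -(@leq_pmul2r (r ^ 2)) ?expn_gt0 ?r0 //.
  apply: (@leq_trans ((T * X) ^ 2)).
    have -> : T * (T %/ r) * (X * (X %/ r)) * r ^ 2
            = (T * X) * ((T %/ r * r) * (X %/ r * r)) by ring.
    by rewrite expnS expn1 leq_mul2l leq_mul ?orbT ?leq_trunc_div.
  apply: (leq_trans Pr1).
  have -> : 8 * r * L * r ^ 2 = 8 * r ^ 3 * L by ring.
  by rewrite leq_mul2r r8 orbT.
by move: (leq_add h1 h2) => /leq_trans -> //; apply: eq_leq; ring.
Qed.

(** The usual extra terms of the Szemeredi-Trotter theorem, linear in the number
of points or of lines, are absent: if the lines outnumber the squared number of
points, then the linear bound [I <= 4 |S| |B|] combines with the two bounds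
[I <= |T| |X| |S|] and [I <= |T| |X| |B|], which hold because any three of
[t], [x], [s], [b] determine the fourth. *)
Lemma grid_szemeredi_trotter (R : realFieldType) (T X S B : seq R) :
    uniq T -> uniq X -> uniq S -> uniq B -> 0%R \notin T -> 0%R \notin S ->
  incidences T X [seq (s, b) | s <- S, b <- B] ^ 3 <=
  13 ^ 3 * (size T * size X * (size S * size B)) ^ 2.
Proof.
move=> uT uX uS uB T0 S0.
set L := [seq (s, b) | s <- S, b <- B]; set I := incidences T X L.
have uL : uniq L by apply: pairs_uniq.
have sL : size L = size S * size B by rewrite size_allpairs.
have L0 : {in L, forall l, l.1 != 0%R}.
  by move=> l; rewrite mem_pairs => /andP[ls _]; apply: contraNneq S0 => <-.
have inj_le (J : seq R) (f : R -> R) : uniq J -> {in J &, injective f} ->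
    \sum_(t <- J) (f t \in X : nat) <= size X.
  move=> uJ injf; apply: (@leq_trans (\sum_(x <- X) (predT x : nat))); last first.
    by rewrite sum_bool_size filter_predT.
  apply: (leq_sum_inj (f := f)) => // [t u|t _ ->] //.
  by rewrite !inE /= => /andP[? _] /andP[? _]; apply: injf.
have IT : I <= size T * size L.
  rewrite mulnC; apply: sum_nat_leq_const => l _.
  by rewrite -[size T]muln1; apply: sum_nat_leq_const => t _; case: (_ \in _).
have IX : I <= size X * size L.
  rewrite mulnC; apply: sum_nat_leq_const => l /L0 l0.
  by apply: inj_le => // t u _ _; apply: line_inj.
have IS : I <= size T * size X * size S.
  rewrite /I /incidences big_allpairs mulnC; apply: sum_nat_leq_const => s _ /=.
  rewrite exchange_big; apply: sum_nat_leq_const => t _ /=.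
  by apply: inj_le => // b c _ _ /addrI /oppr_inj.
have IB : I <= size T * size X * size B.
  rewrite /I /incidences big_allpairs exchange_big mulnC.
  apply: sum_nat_leq_const => b _ /=.
  rewrite exchange_big; apply: sum_nat_leq_const => t tT /=.
  apply: inj_le => // s s' _ _ /addIr /mulIf; apply.
  by apply: contraNneq T0 => <-.
rewrite -sL; have [L_0|Lp] := posnP (size L).
  by move: IT; rewrite L_0 muln0 leqn0 => /eqP ->.
have [T_0|Tp] := posnP (size T).
  by move: IT; rewrite T_0 mul0n leqn0 => /eqP ->.
have [X_0|Xp] := posnP (size X).
  by move: IX; rewrite X_0 mul0n leqn0 => /eqP ->.
have Iq qT qX : 0 < qT -> 0 < qX ->
    I <= size L * (size T %/ qT + size X %/ qX).+1 + (size T * qT) * (size X * qX).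
  exact: incidences_blocks.
have [Lle|Lgt] := leqP (size L) ((size T * size X) ^ 2).
  exact: incidences_cube_leq.
have I4 : I <= 4 * size L.
  apply: (leq_trans (Iq _ _ Tp Xp)); rewrite !divnn Tp Xp.
  rewrite mulnACA mulnn.
  move: (ltnW Lgt).
  by lia.
have I2 : I ^ 2 <= (size T * size X) ^ 2 * size L.
  apply: (leq_trans (leq_mul IS IB)); rewrite sL expnS expn1.
  by apply: eq_leq; ring.
rewrite expnSr; apply: (leq_trans (leq_mul I2 I4)).
apply: (@leq_trans (4 * (size T * size X * size L) ^ 2)); last first.
  by rewrite leq_mul2r orbT.
by apply: eq_leq; ring.
Qed.

(** * Incidences from multiplicative structure *)

Lemma leq_size_inj (I J : eqType) (s : seq I) (t : seq J) (f : I -> J) :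
    uniq s -> {in s &, injective f} -> {in s, forall x, f x \in t} ->
  size s <= size t.
Proof.
move=> us injf sft; rewrite -(size_map f) uniq_leq_size ?map_inj_in_uniq //.
by move=> _ /mapP[x xs ->]; apply: sft.
Qed.

Lemma sum_nat_const_seq (I : Type) (s : seq I) c : \sum_(x <- s) c = size s * c.
Proof. by rewrite big_const_seq count_predT iter_addn_0 mulnC. Qed.

Lemma incidences_geq (R : realFieldType) (T X : seq R) (L : seq (R * R)) m :
    uniq X ->
    {in X, forall x, m <= \sum_(l <- L) \sum_(t <- T) (line l t == x : nat)} ->
  size X * m <= incidences T X L.
Proof.
move=> uX mX; have -> : incidences T X L =
    \sum_(x <- X) \sum_(l <- L) \sum_(t <- T) (line l t == x : nat).
  rewrite exchange_big; apply: eq_bigr => l _ /=.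
  rewrite exchange_big; apply: eq_bigr => t _ /=.
  by rewrite -sum_bool_mem //; apply: eq_bigr => x _; rewrite eq_sym.
rewrite -(count_predT X) -sum1_count big_distrl /= !big_seq.
by apply: leq_sum => x xX; rewrite mul1n mX.
Qed.

Section Multiplicative.
Variables (R : realFieldType) (A : seq R).
Hypotheses (uA : uniq A) (A0 : 0%R \notin A).

Definition rep (x : R) := \sum_(u <- A) ((u - x)%R \in A : nat).
Definition products := undup [seq (a * b)%R | a <- A, b <- A].
Definition quotients := undup [seq (a / b)%R | a <- A, b <- A].
Definition dilates (P : seq R) := undup [seq (a * p)%R | a <- A, p <- P].

Lemma memA_neq0 a : a \in A -> (a != 0)%R.
Proof. by move=> aA; apply: contraNneq A0 => <-. Qed.

Lemma mem_products a b : a \in A -> b \in A -> (a * b)%R \in products.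
Proof. by move=> aA bA; rewrite mem_undup; apply/allpairsP; exists (a, b). Qed.

Lemma mem_quotients a b : a \in A -> b \in A -> (a / b)%R \in quotients.
Proof. by move=> aA bA; rewrite mem_undup; apply/allpairsP; exists (a, b). Qed.

Lemma mem_dilates P a p : a \in A -> p \in P -> (a * p)%R \in dilates P.
Proof. by move=> aA pP; rewrite mem_undup; apply/allpairsP; exists (a, p). Qed.

(** Ruzsa's triangle inequality: a quotient [a / b] and an element [c] are
recovered from the two products [a c] and [b c]. *)
Lemma size_quotients : size quotients * size A <= size products ^ 2.
Proof.
pose AA := [seq (a, b) | a <- A, b <- A].
(* [pr q] is a chosen pair of elements of [A] with quotient [q]. *)
pose pr q := nth (0, 0)%R AA (find (fun p => p.1 / p.2 == q)%R AA).
have prP q : q \in quotients ->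
    [/\ (pr q).1 \in A, (pr q).2 \in A & ((pr q).1 / (pr q).2 = q)%R].
  rewrite mem_undup => /allpairsP[[a b] /= [aA bA qE]].
  have hq : has (fun p => p.1 / p.2 == q)%R AA.
    by apply/hasP; exists (a, b); rewrite ?mem_pairs /= ?aA ?bA ?qE.
  have := mem_nth (0, 0)%R (s := AA) (n := find (fun p => p.1 / p.2 == q)%R AA).
  rewrite -has_find hq => /(_ isT); rewrite mem_pairs => /andP[h1 h2].
  by split=> //; apply/eqP; apply: (nth_find (0, 0)%R hq).
have := @leq_size_inj _ _ [seq (q, c) | q <- quotients, c <- A]
  [seq (x, y) | x <- products, y <- products]
  (fun z => ((pr z.1).1 * z.2, (pr z.1).2 * z.2)%R).
rewrite !size_allpairs mulnn; apply.
- by rewrite pairs_uniq // undup_uniq.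
- move=> [q c] [q' c']; rewrite !mem_pairs /= => /andP[qQ cA] /andP[qQ' cA'].
  have [a1 b1 e1] := prP _ qQ; have [a2 b2 e2] := prP _ qQ'.
  have dil z d : d \in A -> (z.1 / z.2 = (z.1 * d) / (z.2 * d))%R.
    by move=> dA; rewrite -mulf_div divff ?memA_neq0 // mulr1.
  case=> h1 h2; have qq : q = q'.
    by rewrite -e1 -e2 (dil (pr q) c) // (dil (pr q') c') // h1 h2.
  by congr pair => //; move: h1; rewrite qq; apply: mulfI; apply: memA_neq0.
- move=> [q c]; rewrite !mem_pairs /= => /andP[/prP[h1 h2 _] cA].
  by rewrite !mem_products.
Qed.

Lemma dilates_neq0 P : 0%R \notin P -> 0%R \notin dilates P.
Proof.
move=> P0; rewrite mem_undup; apply/allpairsP => -[[a p] /= [aA pP]] /esym/eqP.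
rewrite mulf_eq0 (negPf (memA_neq0 aA)) /= => /eqP p0.
by rewrite -p0 pP in P0.
Qed.

(** For [p = u - v] and any [c] in [A], [a * p = (u / c) * (a * c) - a * v]: at
height [a * p] there are [size A * rep p] incidences with lines of slope in
[A / A] and intercept in [A A], at abscissas in [A A].  Since these three sets are
about as small as [A], few heights can be that rich. *)
Lemma size_dilates_popular K i P :
    size products <= K * size A -> uniq P -> 0%R \notin P ->
    {in P, forall p, 2 ^ i <= rep p} ->
  size (dilates P) * 8 ^ i <= 13 ^ 3 * K ^ 8 * size A ^ 3.
Proof.
move=> AK uP P0 Pi; set Y := dilates P; set n := size A.
have [nA|n0] := posnP n.
  by rewrite /Y /dilates (size0nil nA).
have uY : uniq Y by apply: undup_uniq.
have Q0 : 0%R \notin quotients.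
  rewrite mem_undup; apply/allpairsP => -[[a b] /= [aA bA]] /esym/eqP.
  by rewrite mulf_eq0 invr_eq0 !(negPf (memA_neq0 _)).
have AA0 : 0%R \notin products.
  rewrite mem_undup; apply/allpairsP => -[[a b] /= [aA bA]] /esym/eqP.
  by rewrite mulf_eq0 !(negPf (memA_neq0 _)).
have Qn : size quotients <= K ^ 2 * n.
  rewrite -(leq_pmul2r n0) (leq_trans size_quotients) //.
  by rewrite -mulnA mulnn -expnMn leq_exp2r.
have Ige : size Y * (n * 2 ^ i) <=
    incidences products Y [seq (s, b) | s <- quotients, b <- products].
  apply: incidences_geq => // y; rewrite mem_undup => /allpairsP[[a p] /= [aA pP ->]].
  apply: (@leq_trans (\sum_(c <- A) \sum_(u <- A) ((u - p)%R \in A : nat))).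
    by rewrite sum_nat_const_seq -/(rep p) leq_mul // Pi.
  have := @leq_sum_inj _ _ [seq (c, u) | c <- A, u <- A]
    [seq (l, t) | l <- [seq (s, b) | s <- quotients, b <- products], t <- products]
    (fun z => (z.2 - p)%R \in A) (fun z => line z.1 z.2 == (a * p)%R)
    (fun z => ((z.2 / z.1, a * (z.2 - p)), a * z.1)%R).
  rewrite !big_allpairs /=; apply.
  - by rewrite pairs_uniq.
  - move=> [c u] [c' u']; rewrite !inE !mem_pairs /=.
    move=> /andP[/andP[cA uA'] _] /andP[/andP[cA' uA''] _] [e1 _].
    move=> /(mulfI (memA_neq0 aA)) cc; rewrite cc in e1 *.
    by congr pair; apply: mulIf e1; rewrite invr_eq0 memA_neq0.
  - move=> [c u]; rewrite !mem_pairs /= => /andP[cA uA'] upA.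
    rewrite mem_quotients ?mem_products //= /line /=.
    rewrite mulrCA divfK ?memA_neq0 // -mulrBr.
    by rewrite subKr.
have := grid_szemeredi_trotter (undup_uniq _) uY (undup_uniq _) (undup_uniq _) AA0 Q0
  : incidences products Y [seq (s, b) | s <- quotients, b <- products] ^ 3 <= _.
move: Ige; rewrite -(leq_exp2r _ _ (isT : 0 < 3)) => /leq_trans h /h {h}.
have [->|Y0] := posnP (size Y); first by rewrite mul0n.
move=> h; rewrite -(@leq_pmul2l (size Y ^ 2 * n ^ 3)) ?muln_gt0 ?expn_gt0 ?Y0 ?n0 //.
have -> : size Y ^ 2 * n ^ 3 * (size Y * 8 ^ i) = (size Y * (n * 2 ^ i)) ^ 3.
  by rewrite (_ : 8 ^ i = (2 ^ i) ^ 3); [ring | rewrite -expnM mulnC expnM].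
apply: (leq_trans h).
apply: (@leq_trans (13 ^ 3 * (K * n * size Y * (K ^ 2 * n * (K * n))) ^ 2)).
  rewrite leq_mul2l leq_exp2r // [_ <= _]leq_mul ?orbT //.
    by rewrite leq_mul2r AK orbT.
  exact: leq_mul.
by apply: eq_leq; ring.
Qed.

Lemma size_dilates_geq P : 0 < size A -> uniq P -> size P <= size (dilates P).
Proof.
move=> n0 uP; pose a := nth 0%R A 0; have aA : a \in A by apply: mem_nth.
apply: (leq_size_inj (f := fun p => a * p)%R) => // [p q _ _|p pP].
  by apply: mulfI; apply: memA_neq0.
exact: mem_dilates.
Qed.

(** A solution of [x - y = z] gives [size A] incidences, one for each way to
write [x = (a * x) * a^-1]. *)
Lemma triples_bound P P' P'' :
    uniq P -> uniq P' -> uniq P'' -> 0%R \notin P ->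
  size A * (\sum_(x <- P) \sum_(y <- P') ((x - y)%R \in P'' : nat)) ^ 3 <=
  13 ^ 3 * (size (dilates P) * size P' * size P'') ^ 2.
Proof.
move=> uP uP' uP'' P0; set N := \sum_(x <- P) _; set n := size A.
have [->|n0] := posnP n; first by rewrite mul0n.
pose T := [seq a^-1%R | a <- A].
have uT : uniq T by rewrite map_inj_uniq //; apply: invr_inj.
have T0 : 0%R \notin T.
  by apply/mapP => -[a aA /esym/eqP]; rewrite invr_eq0 (negPf (memA_neq0 aA)).
have NI : n * N <=
    incidences T P'' [seq (s, b) | s <- dilates P, b <- P'].
  have := @leq_sum_inj _ _ [seq (a, p) | a <- A, p <- [seq (x, y) | x <- P, y <- P']]
    [seq (l, t) | l <- [seq (s, b) | s <- dilates P, b <- P'], t <- T]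
    (fun z => (z.2.1 - z.2.2)%R \in P'') (fun z => line z.1 z.2 \in P'')
    (fun z => ((z.1 * z.2.1, z.2.2), z.1^-1)%R).
  rewrite /incidences !big_allpairs /=; under eq_bigr do rewrite big_allpairs /=.
  rewrite sum_nat_const_seq; apply.
  - by rewrite !pairs_uniq.
  - move=> [a [x y]] [a' [x' y']]; rewrite !inE !mem_pairs /=.
    move=> /andP[/andP[aA _] _] _ [e1 -> /invr_inj aa]; rewrite -aa in e1 *.
    by rewrite (mulfI (memA_neq0 aA) e1).
  - move=> [a [x y]]; rewrite !mem_pairs /= => /andP[aA /andP[xP yP]] xyP.
    rewrite mem_dilates // yP map_f //= /line /=.
    by rewrite mulrAC mulfV ?memA_neq0 // mul1r.
have := grid_szemeredi_trotter uT uP'' (undup_uniq _) uP' T0 (dilates_neq0 P0).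
move: NI; rewrite -(leq_exp2r _ _ (isT : 0 < 3)) => /leq_trans h /h {h}.
rewrite size_map -/n -/(dilates P) => h.
rewrite -(@leq_pmul2l (n ^ 2)) ?expn_gt0 ?n0 //.
have -> : n ^ 2 * (n * N ^ 3) = (n * N) ^ 3 by ring.
by apply: (leq_trans h); apply: eq_leq; ring.
Qed.
End Multiplicative.

(** * Spectral bound for the energy *)

Section Energy.
Variables (R : realFieldType) (A : seq R).
Hypothesis uA : uniq A.
Let n := size A.
Notation rep := (rep A).

Definition energy := \sum_(x <- A) \sum_(y <- A) rep (x - y)%R.
Definition diffs := undup [seq (u - v)%R | u <- A, v <- A].

Lemma rep_leq_size x : rep x <= n.
Proof.
rewrite /rep /n -[size A]muln1; apply: sum_nat_leq_const => u _.
by case: (_ \in _).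
Qed.

Lemma rep0 : rep 0%R = n.
Proof.
rewrite /rep big_seq; under eq_bigr => u uA' do rewrite subr0 uA'.
by rewrite -big_seq sum_nat_const_seq muln1.
Qed.

Lemma repN x : rep (- x)%R = rep x.
Proof.
have repN_le y : rep y <= rep (- y)%R.
  apply: (leq_sum_inj (f := fun u => u - y)%R) => // [u v _ _|u uA' ->].
    exact: addIr.
  by rewrite opprK subrK.
by apply/eqP; rewrite eqn_leq repN_le -{2}[x]opprK repN_le.
Qed.

Lemma repC x y : rep (x - y)%R = rep (y - x)%R.
Proof. by rewrite -repN opprB. Qed.

Lemma mem_diffs u v : u \in A -> v \in A -> (u - v)%R \in diffs.
Proof. by move=> uA' vA; rewrite mem_undup; apply/allpairsP; exists (u, v). Qed.

Lemma rep_diffs x : 0 < rep x -> x \in diffs.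
Proof.
rewrite lt0n; apply: contraNT => xD; rewrite /rep big_seq big1 // => u uA'.
apply/eqP; rewrite eqb0; apply: contra xD => vA.
by rewrite -[x](subKr u) mem_diffs.
Qed.

(** Change of variables [t = u - y] between [A] and the set of all differences. *)
Lemma sum_diffs_shift y (F : R -> nat) : y \in A ->
  \sum_(t <- diffs) ((y + t)%R \in A) * F t = \sum_(u <- A) F (u - y)%R.
Proof.
move=> yA; transitivity (\sum_(t <- [seq t <- diffs | (y + t)%R \in A]) F t).
  rewrite big_filter [RHS]big_mkcond; apply: eq_bigr => t _.
  by case: (_ \in _); rewrite ?mul1n ?mul0n.
transitivity (\sum_(t <- [seq (u - y)%R | u <- A]) F t); last by rewrite big_map.
apply: perm_big; apply: uniq_perm.
- by rewrite filter_uniq // undup_uniq.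
- by rewrite map_inj_uniq //; apply: addIr.
move=> t; rewrite mem_filter; apply/andP/mapP => [[ytA _]|[u uA' ->]].
  by exists (y + t)%R => //; rewrite addrAC subrr add0r.
by rewrite mem_diffs // addrC subrK.
Qed.

Lemma rep_gram x y : x \in A -> y \in A ->
  \sum_(t <- diffs) ((x + t)%R \in A) * ((y + t)%R \in A) = rep (x - y)%R.
Proof.
move=> xA yA; rewrite sum_diffs_shift //; apply: eq_bigr => u _.
by congr (nat_of_bool (_ \in A)); ring.
Qed.

Definition triangles :=
  \sum_(x <- A) \sum_(y <- A) \sum_(z <- A)
    rep (x - y)%R * rep (y - z)%R * rep (z - x)%R.

Lemma energy_cube : energy ^ 3 <= n ^ 3 * triangles.
Proof.
have := gram_sum_cube A diffs (fun x t => ((x + t)%R \in A : nat)).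
rewrite /energy /triangles; set a := (X in X ^ 3 <= _).
set b := (X in _ <= _ * X).
suff [-> ->] : a = \sum_(x <- A) \sum_(y <- A) rep (x - y)%R /\
  b = \sum_(x <- A) \sum_(y <- A) \sum_(z <- A)
    rep (x - y)%R * rep (y - z)%R * rep (z - x)%R by [].
split; rewrite /a /b.
  apply: eq_big_seq => x xA.
  by apply: eq_big_seq => y yA; rewrite rep_gram.
apply: eq_big_seq => x xA.
apply: eq_big_seq => y yA.
by apply: eq_big_seq => z zA; rewrite !rep_gram.
Qed.

(** The difference [0] does not spread under dilation by [A], so the incidence
bounds say nothing about it, although its popularity [rep 0 = size A] is the
largest possible. *)
Definition repnz x := if (x == 0)%R then 0 else rep x.

Lemma repnzC x y : repnz (x - y)%R = repnz (y - x)%R.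
Proof. by rewrite /repnz -opprB oppr_eq0 repN. Qed.

(** Equal to the sum of the cubes of [rep], see [third_energy_diffs]; this form
is the one that Cauchy-Schwarz and the diagonal triangles produce. *)
Definition third_energy := \sum_(x <- A) \sum_(y <- A) rep (x - y)%R ^ 2.

Definition offdiag_triangles :=
  \sum_(x <- A) \sum_(y <- A) \sum_(z <- A)
    repnz (x - y)%R * repnz (y - z)%R * repnz (z - x)%R.

(** Each of the three diagonals contributes [rep 0 = n] times the third
energy. *)
Lemma triangles_leq_offdiag : triangles <= offdiag_triangles + 3 * (n * third_energy).
Proof.
pose F x y z := rep (x - y)%R * rep (y - z)%R * rep (z - x)%R.
apply: (@leq_trans (\sum_(x <- A) \sum_(y <- A) \sum_(z <- A)
   (repnz (x - y)%R * repnz (y - z)%R * repnz (z - x)%R +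
   ((x == y) * F x y z + ((y == z) * F x y z + (z == x) * F x y z))))).
  apply: leq_sum => x _; apply: leq_sum => y _; apply: leq_sum => z _.
  rewrite /repnz !subr_eq0 /F; case: eqVneq => _ /=.
    by rewrite mul1n leq_addr.
  case: eqVneq => _ /=; first by rewrite muln0 mul1n leq_addr.
  by case: eqVneq => _ /=; rewrite ?muln0 ?mul0n ?mul1n ?addn0.
have split3 (F1 F2 : R -> R -> R -> nat) :
    \sum_(x <- A) \sum_(y <- A) \sum_(z <- A) (F1 x y z + F2 x y z) =
    \sum_(x <- A) \sum_(y <- A) \sum_(z <- A) F1 x y z +
    \sum_(x <- A) \sum_(y <- A) \sum_(z <- A) F2 x y z.
  rewrite -big_split; apply: eq_bigr => x _ /=.
  by rewrite -big_split; apply: eq_bigr => y _ /=; rewrite -big_split.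
rewrite !split3 leq_add2l.
have delta (x : R) (G : R -> nat) : x \in A ->
    \sum_(y <- A) (x == y) * G y = G x.
  move=> xA; rewrite (bigD1_seq x) //= eqxx mul1n big1 ?addn0 // => y.
  by rewrite eq_sym => /negPf ->.
have -> : \sum_(x <- A) \sum_(y <- A) \sum_(z <- A) (x == y) * F x y z = n * third_energy.
  rewrite /third_energy big_distrr; apply: eq_big_seq => x xA /=.
  under eq_bigr do rewrite -big_distrr /=.
  rewrite delta // big_distrr; apply: eq_bigr => z _ /=.
  by rewrite /F subrr rep0 (repC z) mulnA -mulnA mulnn.
have -> : \sum_(x <- A) \sum_(y <- A) \sum_(z <- A) (y == z) * F x y z = n * third_energy.
  rewrite /third_energy big_distrr; apply: eq_bigr => x xA /=.
  rewrite big_distrr; apply: eq_big_seq => y yA /=.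
  by rewrite delta // /F subrr rep0 (repC y); ring.
have -> : \sum_(x <- A) \sum_(y <- A) \sum_(z <- A) (z == x) * F x y z = n * third_energy.
  rewrite /third_energy big_distrr; apply: eq_big_seq => x xA /=.
  rewrite big_distrr; apply: eq_bigr => y yA /=.
  under eq_bigr do rewrite eq_sym.
  by rewrite delta // /F subrr rep0 (repC y); ring.
by lia.
Qed.

Definition diff_triples := \sum_(a <- diffs) \sum_(c <- diffs)
  (repnz a * repnz c * repnz (a - c)%R) ^ 2.

(** Triangles are grouped by the differences [a = x - y] and [c = z - y].  The
multiplicity [m a c] counts the [y] for which [y + a] and [y + c] are in [A], and
the sum of its squares is again the third energy. *)
Lemma offdiag_sqr : offdiag_triangles ^ 2 <= diff_triples * third_energy.
Proof.
pose H a c := repnz a * repnz c * repnz (a - c)%R.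
pose m a c := \sum_(y <- A) ((y + a)%R \in A) * ((y + c)%R \in A).
have -> : offdiag_triangles = \sum_(a <- diffs) \sum_(c <- diffs) H a c * m a c.
  transitivity (\sum_(y <- A) \sum_(a <- diffs) \sum_(c <- diffs)
      ((y + a)%R \in A) * (((y + c)%R \in A) * H a c)).
    rewrite /offdiag_triangles exchange_big; apply: eq_big_seq => y yA /=.
    transitivity (\sum_(a <- diffs) ((y + a)%R \in A) *
       \sum_(c <- diffs) ((y + c)%R \in A) * H a c); last first.
      by apply: eq_bigr => a _; rewrite big_distrr.
    rewrite sum_diffs_shift //; apply: eq_bigr => x _.
    rewrite sum_diffs_shift //; apply: eq_bigr => z _.
    rewrite /H (repnzC y) (repnzC z x); congr (_ * repnz _); ring.
  rewrite exchange_big; apply: eq_bigr => a _ /=.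
  rewrite exchange_big; apply: eq_bigr => c _ /=.
  by rewrite /m big_distrr; apply: eq_bigr => y _ /=; ring.
apply: (leq_trans (sum_cauchy_schwarz2 _ _ _ _)); rewrite leq_mul2l; apply/orP; right.
apply: eq_leq; transitivity (\sum_(x <- A) \sum_(y <- A)
    (\sum_(t <- diffs) ((x + t)%R \in A) * ((y + t)%R \in A)) ^ 2); last first.
  rewrite /third_energy; apply: eq_big_seq => x xA.
  by apply: eq_big_seq => y yA; rewrite rep_gram.
transitivity (\sum_(a <- diffs) \sum_(c <- diffs) \sum_(x <- A) \sum_(y <- A)
   ((x + a)%R \in A) * ((y + a)%R \in A) * (((x + c)%R \in A) * ((y + c)%R \in A))).
  apply: eq_bigr => a _; apply: eq_bigr => c _; rewrite /m -mulnn big_distrlr /=.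
  by apply: eq_bigr => x _; apply: eq_bigr => y _; rewrite mulnACA.
under eq_bigr do rewrite exchange_big /=.
rewrite exchange_big; apply: eq_bigr => x _ /=.
under eq_bigr do rewrite exchange_big /=.
rewrite exchange_big; apply: eq_bigr => y _ /=.
by rewrite -mulnn big_distrlr.
Qed.

Lemma third_energy_diffs : third_energy = \sum_(a <- diffs) rep a ^ 3.
Proof.
transitivity (\sum_(y <- A) \sum_(a <- diffs) ((y + a)%R \in A) * rep a ^ 2).
  rewrite /third_energy exchange_big; apply: eq_big_seq => y yA /=.
  by rewrite sum_diffs_shift.
rewrite exchange_big; apply: eq_bigr => a _ /=.
rewrite -big_distrl /= expnS; congr (_ * _).
by rewrite -repN; apply: eq_bigr => y _; rewrite opprK.
Qed.

Definition level i := [seq x <- diffs | (x != 0)%R && (2 ^ i <= rep x)].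

Lemma level_uniq i : uniq (level i).
Proof. by rewrite filter_uniq // undup_uniq. Qed.

Lemma mem_level i x : (x \in level i) = (x != 0)%R && (2 ^ i <= rep x).
Proof.
rewrite mem_filter andb_idr // => /andP[_ h]; apply: rep_diffs.
by apply: leq_trans h; rewrite expn_gt0.
Qed.

Let l := trunc_log 2 n.

(** The term [i = trunc_log 2 (rep x)] of the sum already suffices. *)
Lemma repnz_dyadic e x : 0 < e ->
  repnz x ^ e <= 2 ^ e * \sum_(i < l.+1) (2 ^ i) ^ e * (x \in level i).
Proof.
move=> e0; rewrite /repnz; case: eqVneq => [_|x0]; first by rewrite exp0n.
have [->|r0] := posnP (rep x); first by rewrite exp0n.
have /andP[lo hi] := trunc_log_bounds (isT : 1 < 2) r0.
have il : trunc_log 2 (rep x) < l.+1.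
  by rewrite ltnS leq_trunc_log // rep_leq_size.
rewrite (bigD1 (Ordinal il)) //= mem_level x0 lo muln1 mulnDr.
apply: leq_trans (leq_addr _ _); rewrite -expnMn -expnS leq_exp2r //.
exact: ltnW.
Qed.
End Energy.

(** * Dyadic summation *)

(** Bounds that are known only for cubes are summed through the largest
term. *)
Lemma cube_sum_leq m (f : 'I_m -> nat) W :
  (forall i, f i ^ 3 <= W) -> (\sum_i f i) ^ 3 <= m ^ 3 * W.
Proof.
case: m f => [|m] f fW; first by rewrite big_ord0.
have [|i0 max_i0] := bigop.eq_bigmax f; first by rewrite card_ord.
apply: (@leq_trans ((m.+1 * f i0) ^ 3)); last by rewrite expnMn leq_mul2l fW orbT.
have -> : m.+1 * f i0 = \sum_(i < m.+1) f i0 by rewrite sum_nat_const card_ord.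
rewrite leq_exp2r //; apply: leq_sum => i _.
by rewrite -max_i0 leq_bigmax.
Qed.

(** Either the diagonal or the off-diagonal triangles dominate.  In the first
case [E ^ 3] is bounded by [s * n ^ 7], in the second [E ^ 6] is bounded by
[n ^ 6 * (G * F)], both up to constants.  The eighteenth power clears all cube roots, and both cases fit
under [s ^ 18 * n ^ 44]. *)
Lemma combine_bounds (n s M E tr O F G : nat) :
    0 < n -> 0 < s -> E ^ 3 <= n ^ 3 * tr -> tr <= O + 3 * (n * F) ->
    O ^ 2 <= G * F -> F <= 9 * s * M * n ^ 3 ->
    G ^ 3 <= 64 ^ 3 * (s ^ 9 * (13 ^ 3 * M ^ 6 * n ^ 17)) ->
  E ^ 18 <= ((54 * M) ^ 6 + 64 ^ 4 * 13 ^ 3 * 9 ^ 3 * M ^ 9) * s ^ 18 * n ^ 44.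
Proof.
move=> n0 s0 e3 td OGF FM GM.
have [FO|OF] := leqP O (3 * (n * F)).
  have E54 : E ^ 3 <= 54 * M * s * n ^ 7.
    apply: (leq_trans e3); apply: (@leq_trans (n ^ 3 * (6 * (n * (9 * s * M * n ^ 3))))).
      rewrite leq_mul2l; apply/orP; right; apply: (leq_trans td).
      apply: (@leq_trans (6 * (n * F))); first by lia.
      by rewrite leq_mul2l /= leq_mul2l FM orbT.
    by apply: eq_leq; ring.
  have -> : E ^ 18 = (E ^ 3) ^ 6 by rewrite -expnM.
  apply: (@leq_trans ((54 * M * s * n ^ 7) ^ 6)); first by rewrite leq_exp2r.
  rewrite expnMn [(54 * M * s) ^ 6]expnMn -expnM.
  apply: leq_mul; last by rewrite leq_pexp2l.
  apply: leq_mul; last by rewrite leq_pexp2l.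
  exact: leq_addr.
have E6 : E ^ 6 <= 4 * n ^ 6 * (G * F).
  have -> : E ^ 6 = (E ^ 3) ^ 2 by rewrite -expnM.
  apply: (@leq_trans ((n ^ 3 * (2 * O)) ^ 2)).
    rewrite leq_exp2r // (leq_trans e3) // leq_mul2l; apply/orP; right; lia.
  have -> : (n ^ 3 * (2 * O)) ^ 2 = 4 * n ^ 6 * O ^ 2 by ring.
  by rewrite leq_mul2l OGF orbT.
have -> : E ^ 18 = (E ^ 6) ^ 3 by rewrite -expnM.
apply: (@leq_trans ((4 * n ^ 6) ^ 3 * (64 ^ 3 * (s ^ 9 * (13 ^ 3 * M ^ 6 * n ^ 17)) *
    (9 * s * M * n ^ 3) ^ 3))).
  apply: (@leq_trans ((4 * n ^ 6 * (G * F)) ^ 3)); first by rewrite leq_exp2r.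
  rewrite expnMn leq_mul2l [(G * F) ^ 3]expnMn; apply/orP; right.
  by apply: leq_mul => //; rewrite leq_exp2r.
apply: (@leq_trans (64 ^ 4 * 13 ^ 3 * 9 ^ 3 * M ^ 9 * s ^ 12 * n ^ 44)).
  by apply: eq_leq; ring.
apply: leq_mul => //; apply: leq_mul; first exact: leq_addl.
by rewrite leq_pexp2l.
Qed.

Section Counts.
Variables (R : realFieldType) (A : seq R) (K : nat).
Hypotheses (uA : uniq A) (A0 : 0%R \notin A) (n0 : 0 < size A).
Hypothesis AK : size (products A) <= K * size A.
Let n := size A.
Let s := (trunc_log 2 n).+1.
Let M := 13 ^ 3 * K ^ 8.

Lemma level_neq0 i : 0%R \notin level A i.
Proof. by rewrite mem_level eqxx. Qed.

Lemma dilates_level i : size (dilates A (level A i)) * 8 ^ i <= M * n ^ 3.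
Proof.
apply: size_dilates_popular => //; first exact: level_uniq.
  exact: level_neq0.
by move=> p; rewrite mem_level => /andP[].
Qed.

Lemma size_level i : size (level A i) * 8 ^ i <= M * n ^ 3.
Proof.
apply: leq_trans (dilates_level i); rewrite leq_mul2r size_dilates_geq ?orbT //.
exact: level_uniq.
Qed.

Lemma M_gt0 : 0 < M.
Proof.
rewrite muln_gt0 !expn_gt0 /= orbF lt0n; apply/eqP => K0.
have aA : nth 0%R A 0 \in A by apply: mem_nth.
have := mem_products aA aA; move: AK; rewrite K0 mul0n leqn0 size_eq0 => /eqP ->.
by [].
Qed.

Lemma exp8 i : 8 ^ i = (2 ^ i) ^ 3.
Proof. by rewrite -expnM mulnC expnM. Qed.

Lemma third_energy_leq : third_energy A <= 9 * s * M * n ^ 3.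
Proof.
rewrite third_energy_diffs //.
apply: (@leq_trans (\sum_(a <- diffs A) (n ^ 3 * (a == 0%R) + repnz A a ^ 3))).
  apply: leq_sum => a _; rewrite /repnz; case: eqVneq => [->|_].
    by rewrite rep0 // muln1 leq_addr.
  by rewrite muln0.
rewrite big_split /= -big_distrr /= sum_bool_mem ?undup_uniq //.
have h : \sum_(a <- diffs A) repnz A a ^ 3 <= 8 * (s * (M * n ^ 3)).
  apply: (@leq_trans (\sum_(a <- diffs A) 8 *
      \sum_(i < s) (2 ^ i) ^ 3 * (a \in level A i))).
    by apply: leq_sum => a _; apply: repnz_dyadic.
  rewrite -big_distrr leq_mul2l exchange_big /=.
  have -> : s * (M * n ^ 3) = \sum_(i < s) M * n ^ 3 by rewrite sum_nat_const card_ord.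
  apply: leq_sum => i _.
  rewrite -big_distrr /= -exp8 mulnC.
  apply: leq_trans (size_level i); rewrite leq_mul2r; apply/orP; right.
  rewrite sum_bool_size; apply: uniq_leq_size; first by rewrite filter_uniq ?undup_uniq.
  by move=> x; rewrite mem_filter => /andP[].
apply: (@leq_trans (n ^ 3 + 8 * (s * (M * n ^ 3)))).
  rewrite leq_add // -[X in _ <= X]muln1 leq_mul2l.
  by case: (_ \in _); rewrite orbT.
have : n ^ 3 <= s * (M * n ^ 3).
  by rewrite mulnA leq_pmull // muln_gt0 M_gt0.
by move=> h'; apply: (leq_trans (leq_add h' (leqnn _))); apply: eq_leq; ring.
Qed.

Let N i j k := \sum_(x <- level A i) \sum_(y <- level A j)
  ((x - y)%R \in level A k : nat).

(** With [triples_bound], the powers of [8] in the sizes of the three sets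
multiply to [64 ^ (i + j + k)], the cube of the weight [4 ^ (i + j + k)]. *)
Lemma level_triples i j k :
  ((2 ^ i * 2 ^ j * 2 ^ k) ^ 2 * N i j k) ^ 3 <= 13 ^ 3 * M ^ 6 * n ^ 17.
Proof.
rewrite -(@leq_pmul2l n) //.
have h : n * N i j k ^ 3 <= _ := triples_bound uA A0
  (level_uniq A i) (level_uniq A j) (level_uniq A k) (level_neq0 i).
apply: (@leq_trans (13 ^ 3 * (size (dilates A (level A i)) * 8 ^ i *
   (size (level A j) * 8 ^ j) * (size (level A k) * 8 ^ k)) ^ 2)).
  have -> : n * ((2 ^ i * 2 ^ j * 2 ^ k) ^ 2 * N i j k) ^ 3 =
     (8 ^ i * 8 ^ j * 8 ^ k) ^ 2 * (n * N i j k ^ 3).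
    by rewrite !exp8; move: (N i j k) (2 ^ i) (2 ^ j) (2 ^ k) => *; ring.
  apply: (leq_trans (leq_mul (leqnn _) h)); apply: eq_leq; ring.
apply: (@leq_trans (13 ^ 3 * ((M * n ^ 3) * (M * n ^ 3) * (M * n ^ 3)) ^ 2)).
  rewrite leq_mul2l leq_exp2r //; apply/orP; right.
  by rewrite leq_mul ?size_level // leq_mul ?size_level // dilates_level.
by apply: eq_leq; ring.
Qed.

Lemma level_sum i (F : R -> nat) :
  \sum_(x <- level A i) F x = \sum_(x <- diffs A) (x \in level A i) * F x.
Proof.
rewrite big_filter big_mkcond; apply: eq_bigr => x _; rewrite mem_level.
by case: (_ && _); rewrite ?mul1n ?mul0n.
Qed.

Lemma diff_triples_leq : diff_triples A ^ 3 <= 64 ^ 3 * (s ^ 9 * (13 ^ 3 * M ^ 6 * n ^ 17)).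
Proof.
pose t (i j k : 'I_s) := (2 ^ i * 2 ^ j * 2 ^ k) ^ 2 * N i j k.
pose w (i : 'I_s) x := (2 ^ i) ^ 2 * (x \in level A i).
have tE i j k : t i j k = \sum_(p <- [seq (a, c) | a <- diffs A, c <- diffs A])
    w i p.1 * w j p.2 * w k (p.1 - p.2)%R.
  rewrite big_allpairs /t /N level_sum big_distrr; apply: eq_bigr => a _ /=.
  rewrite level_sum !big_distrr; apply: eq_bigr => c _ /=.
  by rewrite /w; ring.
have h : diff_triples A <= 64 * \sum_i \sum_j \sum_k t i j k.
  apply: (@leq_trans (64 * \sum_(p <- [seq (a, c) | a <- diffs A, c <- diffs A])
      \sum_i \sum_j \sum_k w i p.1 * w j p.2 * w k (p.1 - p.2)%R)); last first.
    rewrite leq_mul2l /=; apply: eq_leq.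
    rewrite exchange_big; apply: eq_bigr => i _ /=.
    rewrite exchange_big; apply: eq_bigr => j _ /=.
    by rewrite exchange_big; apply: eq_bigr => k _ /=.
  rewrite big_allpairs /diff_triples big_distrr; apply: leq_sum => a _ /=.
  rewrite big_distrr; apply: leq_sum => c _ /=.
  have := leq_mul (leq_mul (repnz_dyadic A a (isT : 0 < 2)) (repnz_dyadic A c (isT : 0 < 2)))
    (repnz_dyadic A (a - c)%R (isT : 0 < 2)).
  rewrite -!expnMn => /leq_trans; apply; apply: eq_leq.
  transitivity (64 * ((\sum_i w i a) * (\sum_j w j c) * (\sum_k w k (a - c)%R))).
    by rewrite /w /s /n; ring.
  congr (64 * _); rewrite -mulnA big_distrl; apply: eq_bigr => i _ /=.
  rewrite mulnA [w i a * _]big_distrr big_distrl; apply: eq_bigr => j _ /=.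
  by rewrite big_distrr.
apply: (@leq_trans ((64 * \sum_i \sum_j \sum_k t i j k) ^ 3)); first by rewrite leq_exp2r.
rewrite expnMn leq_mul2l; apply/orP; right.
have -> : s ^ 9 = s ^ 3 * s ^ 3 * s ^ 3 by rewrite -!expnD.
rewrite -[s ^ 3 * _ * _ * _]mulnA -[s ^ 3 * _ * _]mulnA.
by do 3!apply: cube_sum_leq => ?; apply: level_triples.
Qed.

Lemma energy_pow18 : energy A ^ 18 <=
  ((54 * M) ^ 6 + 64 ^ 4 * 13 ^ 3 * 9 ^ 3 * M ^ 9) * s ^ 18 * n ^ 44.
Proof.
exact: (combine_bounds n0 (ltn0Sn _) (energy_cube uA) (triangles_leq_offdiag uA)
  (offdiag_sqr uA) third_energy_leq diff_triples_leq).
Qed.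
End Counts.

(** The explicit constant of [energy_pow18] is hidden behind an existential
because unfolding it as a unary number is infeasible. *)
Theorem energy_bound K : exists D, forall (R : realFieldType) (A : seq R),
    uniq A -> 0%R \notin A -> 0 < size A -> size (products A) <= K * size A ->
  energy A ^ 18 <= D * (trunc_log 2 (size A)).+1 ^ 18 * size A ^ 44.
Proof. by eexists=> R A uA A0 n0 AK; apply: energy_pow18 AK. Qed.

(** * Back to finite sets of real numbers *)

(** A solution of [x - y = u - v] involving [0] is determined by the position of
the [0] and two further terms. *)
Lemma energy_drop0 (R : realFieldType) (A : seq R) : uniq A ->
  energy A <= energy [seq a <- A | a != 0%R] + 4 * size A ^ 2.
Proof.
move=> uA; set A' := [seq a <- A | _]; set n := size A.
have drop0 (f : R -> nat) : \sum_(x <- A) f x <= f 0%R + \sum_(x <- A') f x.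
  rewrite big_filter (bigID (pred1 0%R)) /= leq_add2r big_mkcond /=.
  have -> : \sum_(x <- A) (if x == 0%R then f x else 0)
      = (0%R \in A) * f 0%R.
    rewrite -sum_bool_mem // big_distrl; apply: eq_bigr => x _ /=.
    by case: eqVneq => [->|]; rewrite ?mul1n ?mul0n.
  by case: (_ \in _); rewrite ?mul1n ?mul0n.
have sA' : size A' <= n by rewrite size_filter count_size.
have mem0 v : (v \in A : nat) <= (v \in A') + (v == 0%R).
  by rewrite mem_filter; case: (v == 0%R); case: (v \in A).
have repA' z : rep A z <= 2 + rep A' z.
  have : \sum_(u <- A') ((u - z)%R \in A : nat) <= 1 + rep A' z.
    apply: (@leq_trans (\sum_(u <- A') (((u - z)%R \in A') + (u == z)))).
      by apply: leq_sum => u _; apply: leq_trans (mem0 _) _; rewrite subr_eq0.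
    by rewrite big_split /= addnC leq_add2r sum_bool_mem ?filter_uniq // leq_b1.
  by move=> h; apply: (leq_trans (drop0 _)); apply: leq_add (leq_b1 _) h.
apply: (leq_trans (drop0 _)).
have h1 : \sum_(y <- A) rep A (0 - y)%R <= n ^ 2.
  by rewrite -mulnn; apply: sum_nat_leq_const => y _; apply: rep_leq_size.
have h2 : \sum_(x <- A') \sum_(y <- A) rep A (x - y)%R <=
   \sum_(x <- A') (n + \sum_(y <- A') (2 + rep A' (x - y)%R)).
  apply: leq_sum => x _; apply: (leq_trans (drop0 _)).
  by rewrite leq_add ?rep_leq_size //; apply: leq_sum => y _; apply: repA'.
have h3 : \sum_(x <- A') (n + \sum_(y <- A') (2 + rep A' (x - y)%R)) <=
    n ^ 2 + (n * (n * 2) + energy A').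
  rewrite big_split /= sum_nat_const_seq -mulnn leq_add ?leq_mul //.
  under eq_bigr do rewrite big_split /= sum_nat_const_seq.
  by rewrite big_split /= sum_nat_const_seq leq_add // !leq_mul.
apply: (leq_trans (leq_add h1 (leq_trans h2 h3))).
by rewrite -mulnn; lia.
Qed.

(** A quadruple with [a + b = c + d] is read as [a - c = d - b]. *)
Lemma add_energy_leq (R : realType) (A : {fset R}) :
  add_energy A <= energy (enum_fset A).
Proof.
rewrite /add_energy; set F := (X in #|` X|).
have -> : #|` F| = \sum_(q <- enum_fset F) (predT q : nat).
  by rewrite sum_bool_size filter_predT.
have := @leq_sum_inj _ _ (enum_fset F)
  [seq (p, u) | p <- [seq (x, y) | x <- enum_fset A, y <- enum_fset A], u <- enum_fset A]
  predT (fun z => (z.2 - (z.1.1 - z.1.2))%R \in enum_fset A)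
  (fun q => ((q.1.1, q.2.1), q.2.2)).
have FP q : q \in enum_fset F -> [/\ q.1.1 \in A, q.1.2 \in A, q.2.1 \in A,
    q.2.2 \in A & (q.1.1 + q.1.2 = q.2.1 + q.2.2)%R].
  rewrite !inE /= => /andP[/andP[/andP[? ?] /andP[? ?]] /eqP ?]; split=> //.
rewrite !big_allpairs /=; apply.
- exact: fset_uniq.
- move=> [[a b] [c d]] [[a' b'] [c' d']].
  move=> /andP[/FP[_ _ _ _ /= e] _] /andP[/FP[_ _ _ _ /= e'] _] [aa cc dd].
  rewrite -aa -cc -dd in e' *.
  by move: e; rewrite -e' => /addrI ->.
- move=> [[a b] [c d]] /FP[/= aA bA cA dA e] _.
  rewrite !mem_pairs /= aA cA dA /=.
  by rewrite opprB addrA [(d + c)%R]addrC -e addrAC subrr add0r.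
Qed.

Lemma log2_ge (R : realType) (m n : nat) : 2 ^ m <= n -> (m%:R <= log2 n%:R :> R)%R.
Proof.
move=> mn; have ln2 : (0 < ln 2 :> R)%R by apply: ln_gt0; rewrite ltr1n.
have p0 : (0 < 2 ^ m)%N by rewrite expn_gt0.
rewrite /log2 ler_pdivlMr // mulr_natl -lnXn // ler_ln ?posrE ?exprn_gt0 //.
  by rewrite -natrX ler_nat.
by rewrite ltr0n (leq_trans p0).
Qed.

Local Open Scope ring_scope.

(** [(n ^ (22/9)) ^ 18 = n ^ 44] turns [energy_bound] into the stated exponent, and
[2 <= n] makes the logarithm at least [1], which absorbs all other terms. *)
Theorem theorem2 (R : realType) :
  exists c : R, 0 < c /\
    forall K : R, 1 <= K ->
      exists C : R, 0 < C /\
        forall A : {fset R},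
          (2 <= #|` A|)%N ->
          #|` prodset A|%:R <= K * #|` A|%:R ->
          (add_energy A)%:R <=
            C * (#|` A|%:R `^ (22 / 9)) * (log2 #|` A|%:R `^ c).
Proof.
exists 1; split; first exact: ltr01.
move=> K K1.
have K2_ge0 : 0 <= 2 * K by lra.
(* Removing [0] from [A] may halve its size, hence the factor [2]. *)
set K0 := Num.Def.archi_bound (2 * K).
have K0P : 2 * K <= K0%:R by apply: ltW; apply: archi_boundP.
have [D energyD] := energy_bound K0.
exists (2 * D.+1%:R + 4); split; first by rewrite ltr_wpDl // mulr_ge0.
move=> A A2 AK.
set n := #|` A| in A2 AK *.
pose S := enum_fset A; pose S' := [seq a <- S | a != 0].
have uS' : uniq S' by rewrite filter_uniq // fset_uniq.
have S'0 : 0 \notin S' by rewrite mem_filter eqxx.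
have sS' : (size S' <= n)%N by rewrite size_filter count_size.
have sS'1 : (n <= (size S').+1)%N.
  rewrite /n -(count_predC (fun a => a != 0) S) -size_filter -addn1 leq_add2l.
  rewrite (eq_count (a2 := pred1 0)) => [|a /=]; last by rewrite negbK.
  by rewrite count_uniq_mem ?fset_uniq // leq_b1.
have S'K : (size (products S') <= K0 * size S')%N.
  have : (size (products S') <= #|` prodset A|)%N.
    apply: uniq_leq_size; first exact: undup_uniq.
    move=> x; rewrite mem_undup => /allpairsP[[a b] /= []].
    rewrite !mem_filter => /andP[_ aA] /andP[_ bA] ->.
    by apply/imfset2P; exists a => //; exists b.
  rewrite -(ler_nat R) => /le_trans /(_ AK) h.
  rewrite -(ler_nat R) natrM; apply: (le_trans h).
  have nS : n%:R <= 2 * (size S')%:R :> R by rewrite -natrM ler_nat; lia.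
  apply: (@le_trans _ _ (K * (2 * (size S')%:R))); first by rewrite ler_pM2l //; lra.
  by rewrite mulrA [K * 2]mulrC ler_wpM2r.
have s0 : (0 < size S')%N by lia.
have E18 := energyD R S' uS' S'0 s0 S'K.
set L := log2 n%:R.
have L1 : 1 <= L by apply: (log2_ge _ (m := 1)).
have n1 : 1 <= n%:R :> R by rewrite ler1n; lia.
have n0 : 0 <= n%:R :> R by lra.
set q := n%:R `^ (22 / 9).
have q0 : 0 <= q by apply: powR_ge0.
have q18 : q ^+ 18 = n%:R ^+ 44.
  by rewrite /q -powR_mulrn // -powRrM -powR_mulrn //; congr (_ `^ _); lra.
have q2 : n%:R ^+ 2 <= q.
  by rewrite -powR_mulrn // ler_powR //; lra.
have sL : (trunc_log 2 (size S')).+1%:R <= 2 * L.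
  have : (trunc_log 2 (size S'))%:R <= L.
    apply: log2_ge; apply: leq_trans sS'; exact: trunc_logP.
  by rewrite -natr1; lra.
have L0 : 0 <= L by apply: le_trans L1.
clearbody L q.
have ES' : (energy S')%:R <= D.+1%:R * (2 * L) * q.
  rewrite -(@ler_pXn2r _ 18) ?nnegrE ?mulr_ge0 //.
  rewrite 2!exprMn q18; move: E18; rewrite -(ler_nat R) natrX 2!natrM !natrX => /le_trans; apply.
  apply: ler_pM; rewrite ?mulr_ge0 ?exprn_ge0 //; last first.
    by rewrite lerXn2r ?nnegrE // ler_nat.
  apply: ler_pM; rewrite ?exprn_ge0 //; last first.
    by rewrite lerXn2r ?nnegrE // mulr_ge0 //.
  by rewrite -natrX ler_nat (leq_trans (leqnSn D)) // -[X in (X <= _)%N]expn1 leq_pexp2l.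
have AS' : (add_energy A)%:R <= (energy S')%:R + 4 * n%:R ^+ 2 :> R.
  rewrite -natrX -natrM -natrD ler_nat.
  exact: leq_trans (add_energy_leq A) (energy_drop0 (fset_uniq A)).
apply: (le_trans AS'); rewrite powRr1 //.
have qL : q <= q * L by rewrite ler_peMr.
have -> : (2 * D.+1%:R + 4) * q * L = D.+1%:R * (2 * L) * q + 4 * (q * L) by ring.
by apply: lerD => //; rewrite ler_pM2l // (le_trans q2).
Qed.
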